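(* Let $P$ be the probability distribution on $\mathbb R$ with probability density function $f(x)=\frac25$ for $0\le x\le\frac12$, $f(x)=\frac85$ for $\frac12<x\le1$, and $f(x)=0$ otherwise. Then $\{\frac{59}{332},\frac{177}{332},\frac{239}{332},\frac{301}{332}\}$ is the unique optimal set of four-means for $P$, with quantization error $V_4(P)=\frac{1465}{330672}$.
   Context: For a Borel probability measure $P$ on $\mathbb R$ and $n\ge1$, the $n$th quantization error is $V_n(P)=\inf\{\int \min_{a\in\alpha}(x-a)^2\,dP(x):\alpha\subset\mathbb R,\ \mathrm{card}(\alpha)\le n\}$. A set $\alpha$ with $\mathrm{card}(\alpha)\le n$ attaining the infimum is called an optimal set of $n$-means; for absolutely continuous $P$ it has exactly $n$ elements. *)

(* Defs.v *)
From HB Require Import structures.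
From mathcomp Require Import all_boot all_order all_algebra.
From mathcomp Require Import finmap.
From mathcomp Require Import all_classical all_reals all_analysis.
Set Implicit Arguments.
Unset Strict Implicit.
Unset Printing Implicit Defensive.

Import Order.TTheory GRing.Theory Num.Theory.
Import numFieldNormedType.Exports.

Local Open Scope classical_set_scope.
Local Open Scope fset_scope.
Local Open Scope ring_scope.

(* The minimum over
   a nonempty [alpha] is finite; over [fset0] it is [+oo], so the empty set is
   never better than a nonempty one. *)
Definition min_sqdist (R : realType) (alpha : {fset R}) (x : R) : \bar R :=
  \big[Order.min/+oo%E]_(a <- alpha) ((x - a) ^+ 2)%:E.

Definition distortion (R : realType) (P : probability (measurableTypeR R) R)
    (alpha : {fset R}) : \bar R :=
  (\int[P]_x min_sqdist alpha x)%E.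

Definition quantization_error (R : realType)
    (P : probability (measurableTypeR R) R) (n : nat) : \bar R :=
  ereal_inf [set distortion P alpha | alpha in
    [set alpha : {fset R} | (#|` alpha| <= n)%N]].

Definition optimal_set_of_means (R : realType)
    (P : probability (measurableTypeR R) R) (n : nat) (alpha : {fset R}) :
    Prop :=
  (#|` alpha| <= n)%N /\ distortion P alpha = quantization_error P n.

Definition has_density (R : realType)
    (P : probability (measurableTypeR R) R) (f : R -> R) : Prop :=
  forall A : set (measurableTypeR R), measurable A ->
    P A = (\int[@lebesgue_measure R]_(x in A) (f x)%:E)%E.

Definition two_step_density (R : realType) (x : R) : R :=
  if 0 <= x <= 1 / 2 then 2 / 5
  else if 1 / 2 < x <= 1 then 8 / 5
  else 0.

(* Main.v *)
(* The density is 2/5 times 1 on [0, 1/2] and 4 on [1/2, 1].  For codepoints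
   a1 <= a2 <= a3 <= a4 the distortion is a sum over Voronoi cells, at most one
   of which crosses 1/2, and a cell of length h inside one half costs at least
   h^3/12 times its weight, so k cells filling a half cost at least
   1/(96 k^2) times its weight.  Cutting the crossing cell at 1/2, this already
   excludes every configuration except one cell on the left of the crossing
   cell and two on its right.  There, writing 1/2 + d for the codepoint of the
   crossing cell and optimizing all the other lengths, the cost is at least the
   cubic (1/2+d)^3/27 + 4(1/2-d)^3/75 + d^3, which exceeds its value at
   d = 11/332 by a multiple of (d - 11/332)^2 that is positive for d >= -1/8;
   for d < -1/8 a cruder estimate suffices.  The equality cases give
   uniqueness. *)
Require Import Defs.
From mathcomp Require Import all_boot all_order all_algebra.
From mathcomp Require Import finmap.
From mathcomp Require Import all_classical all_reals all_analysis.
From mathcomp Require Import measurable_realfun.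
From mathcomp Require Import ring lra.

Set Implicit Arguments.
Unset Strict Implicit.
Unset Printing Implicit Defensive.

Import Order.TTheory GRing.Theory Num.Theory.
Import numFieldNormedType.Exports.

Local Open Scope fset_scope.
Local Open Scope ring_scope.

(** * Costs of cells and of rows of cells *)

(** This is the integral of (x - a)^2 over [l, r], see [integral_sqdist]. The closed form keeps the
    whole optimization algebraic, over any [realFieldType]. *)
Definition cell_cost (R : realFieldType) (l r a : R) : R :=
  ((r - a) ^+ 3 - (l - a) ^+ 3) / 3.

(** Parallel axis formula: the cost about the midpoint plus the length times the squared offset of
    [a] from it. *)
Lemma cell_costE (R : realFieldType) (l r a : R) :
  cell_cost l r a = (r - l) ^+ 3 / 12 + (r - l) * (a - (l + r) / 2) ^+ 2.
Proof. by rewrite /cell_cost; field. Qed.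

Lemma cell_cost_ge (R : realFieldType) (l r a : R) :
  l <= r -> (r - l) ^+ 3 / 12 <= cell_cost l r a.
Proof.
by move=> lr; rewrite cell_costE lerDl mulr_ge0 ?sqr_ge0 ?subr_ge0.
Qed.

Lemma cell_cost_eq (R : realFieldType) (l r a : R) :
  l < r -> cell_cost l r a = (r - l) ^+ 3 / 12 -> a = (l + r) / 2.
Proof.
move=> lr; rewrite cell_costE => E.
have /eqP : (r - l) * (a - (l + r) / 2) ^+ 2 = 0 by lra.
by rewrite mulf_eq0 expf_eq0 /= subr_eq0 gt_eqF //= subr_eq0 => /eqP.
Qed.

(** Up to a common factor, x^3 is the cost of one cell of length x and y^3 / n^2 that of n equal
    cells filling y. At fixed x + y the sum is smallest when all n + 1 cells are equal, hence the
    double root at y = n x. *)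
Lemma cube_split (R : realFieldType) (n x y : R) : 0 < n ->
  x ^+ 3 + y ^+ 3 / n ^+ 2 - (x + y) ^+ 3 / (n + 1) ^+ 2 =
  (n * x - y) ^+ 2 *
    (n * (n + 2) * x + (2 * n + 1) * y) / (n ^+ 2 * (n + 1) ^+ 2).
Proof.
move=> n0; field.
by rewrite !gt_eqF // addr_gt0.
Qed.

Lemma cube_split_ge (R : realFieldType) (n x y : R) : 0 < n ->
  0 <= x -> 0 <= y -> (x + y) ^+ 3 / (n + 1) ^+ 2 <= x ^+ 3 + y ^+ 3 / n ^+ 2.
Proof.
move=> n0 x0 y0; rewrite -subr_ge0 cube_split //.
have n1 : 0 <= n by exact: ltW.
by rewrite !(sqr_ge0, invr_ge0, mulr_ge0, addr_ge0).
Qed.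

Lemma cube_split_eq (R : realFieldType) (n x y : R) : 0 < n ->
  0 <= x -> 0 <= y -> 0 < x + y ->
  x ^+ 3 + y ^+ 3 / n ^+ 2 = (x + y) ^+ 3 / (n + 1) ^+ 2 -> y = n * x.
Proof.
move=> n0 x0 y0 xy /eqP; rewrite -subr_eq0 cube_split // mulf_eq0.
have D : n ^+ 2 * (n + 1) ^+ 2 != 0.
  by rewrite gt_eqF // mulr_gt0 ?exprn_gt0 ?addr_gt0.
rewrite invr_eq0 (negbTE D) orbF mulf_eq0 expf_eq0 /= subr_eq0.
case/orP=> [/eqP->//|/eqP E].
(* The linear factor is a sum of nonnegative terms; its vanishing would force x = y = 0, against 0 <
   x + y. *)
have A : 0 < n * (n + 2) by rewrite mulr_gt0 ?addr_gt0.
have B : 0 < 2 * n + 1 by lra.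
have Ax : 0 <= n * (n + 2) * x by rewrite mulr_ge0 // ltW.
have By : 0 <= (2 * n + 1) * y by rewrite mulr_ge0 // ltW.
have /eqP : n * (n + 2) * x = 0 by lra.
rewrite mulf_eq0 (gt_eqF A) /= => /eqP ?.
have /eqP : (2 * n + 1) * y = 0 by lra.
by rewrite mulf_eq0 (gt_eqF B) /= => /eqP ?; lra.
Qed.

(** This bound and the next two add one cell at a time: [cube_split_ge] with n = 1, 2, 3 turns 1/12
    into 1/(12 k^2) for k = 2, 3, 4 cells. *)
Lemma cost2_ge (R : realFieldType) (l p r a b : R) : l <= p -> p <= r ->
  (r - l) ^+ 3 / 48 <= cell_cost l p a + cell_cost p r b.
Proof.
move=> lp pr; have A := cell_cost_ge a lp; have B := cell_cost_ge b pr.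
have := @cube_split_ge R 1 (r - p) (p - l) ltac:(lra) ltac:(lra) ltac:(lra).
have -> : r - p + (p - l) = r - l by ring.
have -> : (1 + 1) ^+ 2 = 4 :> R by ring.
have -> : 1 ^+ 2 = 1 :> R by ring.
lra.
Qed.

Lemma cost3_ge (R : realFieldType) (l p q r a b c : R) :
  l <= p -> p <= q -> q <= r ->
  (r - l) ^+ 3 / 108 <= cell_cost l p a + cell_cost p q b + cell_cost q r c.
Proof.
move=> lp pq qr; have A := cost2_ge a b lp pq; have B := cell_cost_ge c qr.
have := @cube_split_ge R 2 (r - q) (q - l) ltac:(lra) ltac:(lra) ltac:(lra).
have -> : r - q + (q - l) = r - l by ring.
have -> : (2 + 1) ^+ 2 = 9 :> R by ring.
have -> : 2 ^+ 2 = 4 :> R by ring.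
lra.
Qed.

Lemma cost4_ge (R : realFieldType) (l p q s r a b c d : R) :
  l <= p -> p <= q -> q <= s -> s <= r ->
  (r - l) ^+ 3 / 192 <=
  cell_cost l p a + cell_cost p q b + cell_cost q s c + cell_cost s r d.
Proof.
move=> lp pq qs sr; have A := cost3_ge a b c lp pq qs.
have B := cell_cost_ge d sr.
have := @cube_split_ge R 3 (r - s) (s - l) ltac:(lra) ltac:(lra) ltac:(lra).
have -> : r - s + (s - l) = r - l by ring.
have -> : (3 + 1) ^+ 2 = 16 :> R by ring.
have -> : 3 ^+ 2 = 9 :> R by ring.
lra.
Qed.

(** * The cell that crosses 1/2 *)

(* The crossing cell [1/2 - u, 1/2 + v] served by [1/2 + d]. *)
Definition crossing_cost (R : realFieldType) (u v d : R) : R :=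
  ((u + d) ^+ 3 + 4 * (v - d) ^+ 3 + 3 * d ^+ 3) / 3.

(** Parallel axis formula for a cell of mass u + 4v with centroid 1/2 + d. Unlike [a], the centroid
    surely lies in the cell, so u + d and v - d are nonnegative and can enter [cube_split_ge]. *)
Lemma crossing_cost_centroid (R : realFieldType) (u v a : R) :
  0 <= u -> 0 <= v -> exists d,
  [/\ - u <= d, d <= v &
   cell_cost (1 / 2 - u) (1 / 2) a + 4 * cell_cost (1 / 2) (1 / 2 + v) a =
   crossing_cost u v d + (u + 4 * v) * (a - 1 / 2 - d) ^+ 2].
Proof.
move=> u0 v0; have [uv|uv] := ltP 0 (u + 4 * v); last first.
  have -> : u = 0 by lra. have -> : v = 0 by lra.
  by exists 0; split; [lra|lra|rewrite /cell_cost /crossing_cost; field].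
(* The first moment about 1/2 divided by the mass. *)
exists ((2 * v ^+ 2 - u ^+ 2 / 2) / (u + 4 * v)); split.
- by rewrite ler_pdivlMr //; nra.
- by rewrite ler_pdivrMr //; nra.
- rewrite /cell_cost /crossing_cost; field.
  by rewrite gt_eqF.
Qed.

(** A half-cell of length h, served from one end, costs h^3 / 3. With all lengths optimal, three
    equal half-cells of weight 1 lie left of 1/2 + d and five of weight 4 lie right of it; d^3
    corrects the weight between 1/2 and 1/2 + d. So the other cells count as n = 2 and n = 4
    half-cells in [near_center_cost]. *)
Definition center_cost (R : realFieldType) (d : R) : R :=
  (1 / 2 + d) ^+ 3 / 27 + 4 * (1 / 2 - d) ^+ 3 / 75 + d ^+ 3.

(** Expansion of the cubic at its critical point 11/332. The constant is 5/2 times the claimed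
    error, since the common factor 2/5 of the density is left out. *)
Lemma center_costE (R : realFieldType) (d : R) :
  center_cost d = 7325 / (6 * 332 ^+ 2)
    + (d - 11 / 332) ^+ 2 * ((1328 * d + 271) / 1350).
Proof. by rewrite /center_cost; field. Qed.

Lemma center_cost_ge (R : realFieldType) (d : R) : - 1 / 8 <= d ->
  7325 / (6 * 332 ^+ 2) <= center_cost d.
Proof.
move=> d8; rewrite center_costE lerDl; apply: mulr_ge0; first exact: sqr_ge0.
by lra.
Qed.

Lemma center_cost_eq (R : realFieldType) (d : R) : - 1 / 8 <= d ->
  center_cost d = 7325 / (6 * 332 ^+ 2) -> d = 11 / 332.
Proof.
move=> d8; rewrite center_costE; set e := (_ / 1350) => E.
have e0 : 0 < e by rewrite /e; lra.
have /eqP : (d - 11 / 332) ^+ 2 * e = 0.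
  by apply: (@addrI _ (7325 / (6 * 332 ^+ 2))); rewrite addr0.
by rewrite mulf_eq0 (gt_eqF e0) orbF expf_eq0 /= subr_eq0 => /eqP.
Qed.

(** The left half costs at least as much as two equal cells, 1/384. On the right, two cells of
    length 1/4 have their first codepoint at distance 1/8 from 1/2, so a codepoint at distance at
    least 1/8 on the other side saves nothing over them, and the cost is at least 1/96. *)
Lemma far_center_cost (R : realFieldType) (p w u v d : R) :
  0 <= p -> 0 <= w -> 0 <= u -> 0 <= v -> p + u = 1 / 2 -> w + v = 1 / 2 ->
  - u <= d -> d <= - 1 / 8 ->
  5 / 384 <= p ^+ 3 / 12 + crossing_cost u v d + w ^+ 3 / 12.
Proof.
move=> p0 w0 u0 v0 pu wv ud d8.
have L : 1 / 384 <= p ^+ 3 / 12 + ((u + d) ^+ 3 + (- d) ^+ 3) / 3.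
  have := @cube_split_ge R 1 (u + d) (- d) ltac:(lra) ltac:(lra) ltac:(lra).
  have := @cube_split_ge R 1 p u ltac:(lra) ltac:(lra) ltac:(lra).
  rewrite (_ : u + d + - d = u) ?pu; last by ring.
  rewrite (_ : (1 + 1) ^+ 2 = 4 :> R); last by ring.
  rewrite (_ : 1 ^+ 2 = 1 :> R); last by ring.
  have -> : (1 / 2) ^+ 3 = 1 / 8 :> R by field.
  lra.
have M : 1 / 96 <= 4 / 3 * ((v - d) ^+ 3 + d ^+ 3) + w ^+ 3 / 12.
  have -> : w = 1 / 2 - v by lra.
  have e0 : 0 <= - d - 1 / 8 by lra.
  move: e0; set e := - d - 1 / 8 => e0; have -> : d = - (e + 1 / 8).
    by rewrite /e; lra.
  have ve := mulr_ge0 v0 e0. have vve := mulr_ge0 v0 ve.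
  have vee := mulr_ge0 ve e0. have vv := mulr_ge0 v0 v0.
  have vvv := mulr_ge0 v0 vv.
  (* In v and e = - d - 1/8 the difference has only nonnegative terms; 1/8 is exactly where the term
     linear in v alone cancels. *)
  rewrite -subr_ge0.
  have -> : 4 / 3 * ((v - - (e + 1 / 8)) ^+ 3 + (- (e + 1 / 8)) ^+ 3) +
     (1 / 2 - v) ^+ 3 / 12 - 1 / 96 =
     5 / 4 * (v * (v * v)) + 4 * (v * (v * e)) + 4 * (v * e * e) + v * e
     + 5 / 8 * (v * v).
    by field.
  lra.
have E : p ^+ 3 / 12 + crossing_cost u v d + w ^+ 3 / 12 =
   (p ^+ 3 / 12 + ((u + d) ^+ 3 + (- d) ^+ 3) / 3) +
   (4 / 3 * ((v - d) ^+ 3 + d ^+ 3) + w ^+ 3 / 12).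
  by rewrite /crossing_cost; field.
by rewrite E; lra.
Qed.

(* [p] and [w] are the lengths covered by the other codepoints. *)
Lemma near_center_cost (R : realFieldType) (p w u v d : R) :
  0 <= p -> 0 <= w -> 0 <= u -> 0 <= v -> p + u = 1 / 2 -> w + v = 1 / 2 ->
  - u <= d -> d <= v ->
  center_cost d <= p ^+ 3 / 12 + crossing_cost u v d + w ^+ 3 / 12.
Proof.
move=> p0 w0 u0 v0 pu wv ud dv.
have := @cube_split_ge R 2 (u + d) p ltac:(lra) ltac:(lra) p0.
have := @cube_split_ge R 4 (v - d) w ltac:(lra) ltac:(lra) w0.
rewrite (_ : u + d + p = 1 / 2 + d); last by lra.
rewrite (_ : v - d + w = 1 / 2 - d); last by lra.
rewrite (_ : (2 + 1) ^+ 2 = 9); last by ring.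
rewrite (_ : 2 ^+ 2 = 4); last by ring.
rewrite (_ : (4 + 1) ^+ 2 = 25); last by ring.
rewrite (_ : 4 ^+ 2 = 16); last by ring.
rewrite (_ : p ^+ 3 / 12 + _ + _ = ((u + d) ^+ 3 + p ^+ 3 / 4) / 3
   + 4 * ((v - d) ^+ 3 + w ^+ 3 / 16) / 3 + d ^+ 3); last first.
  by rewrite /crossing_cost; field.
by rewrite /center_cost; lra.
Qed.

(** Both splittings must be equalities, so p = 2 (u + d) and w = 4 (v - d). The strict bounds on d
    make the split lengths 1/2 + d and 1/2 - d positive, as [cube_split_eq] requires. *)
Lemma near_center_cost_eq (R : realFieldType) (p w u v d : R) :
  0 <= p -> 0 <= w -> 0 <= u -> 0 <= v -> p + u = 1 / 2 -> w + v = 1 / 2 ->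
  - u <= d -> d <= v -> - 1 / 2 < d -> d < 1 / 2 ->
  p ^+ 3 / 12 + crossing_cost u v d + w ^+ 3 / 12 = center_cost d ->
  u = (1 / 2 - 2 * d) / 3 /\ v = (1 / 2 + 4 * d) / 5.
Proof.
move=> p0 w0 u0 v0 pu wv ud dv d1 d2.
rewrite (_ : p ^+ 3 / 12 + _ + _ = ((u + d) ^+ 3 + p ^+ 3 / 4) / 3
   + 4 * ((v - d) ^+ 3 + w ^+ 3 / 16) / 3 + d ^+ 3); last first.
  by rewrite /crossing_cost; field.
rewrite /center_cost => E.
have L := @cube_split_ge R 2 (u + d) p ltac:(lra) ltac:(lra) p0.
have M := @cube_split_ge R 4 (v - d) w ltac:(lra) ltac:(lra) w0.
have Le := @cube_split_eq R 2 (u + d) p ltac:(lra) ltac:(lra) p0 ltac:(lra).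
have Me := @cube_split_eq R 4 (v - d) w ltac:(lra) ltac:(lra) w0 ltac:(lra).
rewrite (_ : u + d + p = 1 / 2 + d) in L Le; last by lra.
rewrite (_ : v - d + w = 1 / 2 - d) in M Me; last by lra.
rewrite (_ : (2 + 1) ^+ 2 = 9) in L Le; last by ring.
rewrite (_ : 2 ^+ 2 = 4) in L Le; last by ring.
rewrite (_ : (4 + 1) ^+ 2 = 25) in M Me; last by ring.
rewrite (_ : 4 ^+ 2 = 16) in M Me; last by ring.
have := Le ltac:(lra).
have := Me ltac:(lra).
by split; lra.
Qed.

(** * Lower bounds according to the position of the crossing cell *)

(* Either the cost is far above the optimum, or [1/2 + d] serves the crossing
   cell, with one codepoint to its left and two to its right. *)
Definition center_bound (R : realFieldType) (a1 a2 a3 a4 T : R) : Prop :=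
  5 / 432 <= T \/ exists d, [/\ - 1 / 8 <= d, center_cost d <= T &
    T = center_cost d -> d < 1 / 2 ->
    [/\ a1 = (1 + 2 * d) / 6, a2 = 1 / 2 + d, a3 = (7 + 6 * d) / 10
      & a4 = (9 + 2 * d) / 10]].

(** The configuration of the optimum. Each inequality is carried along with its equality case,
    because equality in the total forces equality in every one of them. *)
Lemma cost_crossing_second (R : realFieldType) (a1 a2 a3 a4 s r2 r3 : R) :
  0 <= s -> s <= 1 / 2 -> 1 / 2 <= r2 -> r2 <= r3 -> r3 <= 1 ->
  let T := cell_cost 0 s a1 + cell_cost s (1 / 2) a2 +
    4 * (cell_cost (1 / 2) r2 a2 + cell_cost r2 r3 a3 + cell_cost r3 1 a4) in
  center_bound a1 a2 a3 a4 T.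
Proof.
move=> s0 s1 r20 r23 r31.
have [||d [ud dv]] := @crossing_cost_centroid R (1 / 2 - s) (r2 - 1 / 2) a2.
- lra.
- lra.
rewrite (_ : 1 / 2 - (1 / 2 - s) = s); last by lra.
rewrite (_ : 1 / 2 + (r2 - 1 / 2) = r2); last by lra.
set M := 1 / 2 - s + _.
have M0 : 0 <= M by rewrite /M; lra.
have Q0 : 0 <= M * (a2 - 1 / 2 - d) ^+ 2 by rewrite mulr_ge0 ?sqr_ge0.
have Qe : 0 < M -> M * (a2 - 1 / 2 - d) ^+ 2 = 0 -> a2 = 1 / 2 + d.
  move=> M1 /eqP; rewrite mulf_eq0 (gt_eqF M1) expf_eq0 /= => /eqP; lra.
have A := cell_cost_ge a1 s0; rewrite subr0 in A.
have B := cell_cost_ge a3 r23.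
have C := cell_cost_ge a4 r31.
have D := @cube_split_ge R 1 (r3 - r2) (1 - r3)
  ltac:(lra) ltac:(lra) ltac:(lra).
have De := @cube_split_eq R 1 (r3 - r2) (1 - r3)
  ltac:(lra) ltac:(lra) ltac:(lra).
rewrite (_ : r3 - r2 + (1 - r3) = 1 - r2) in D De; last by ring.
rewrite (_ : (1 + 1) ^+ 2 = 4 :> R) in D De; last by ring.
rewrite expr1n divr1 in D De.
have As : 0 < s -> cell_cost 0 s a1 = s ^+ 3 / 12 -> a1 = s / 2.
  by move=> h; have := @cell_cost_eq R 0 s a1 h; rewrite subr0 add0r.
have Bs := @cell_cost_eq R r2 r3 a3.
have Cs := @cell_cost_eq R r3 1 a4.
move: Q0 Qe A B C D De As Bs Cs.
have F := @far_center_cost R s (1 - r2) (1 / 2 - s) (r2 - 1 / 2) d s0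
  ltac:(lra) ltac:(lra) ltac:(lra) ltac:(lra) ltac:(lra) ud.
have G := @near_center_cost R s (1 - r2) (1 / 2 - s) (r2 - 1 / 2) d s0
  ltac:(lra) ltac:(lra) ltac:(lra) ltac:(lra) ltac:(lra) ud dv.
have Ge := @near_center_cost_eq R s (1 - r2) (1 / 2 - s) (r2 - 1 / 2) d s0
  ltac:(lra) ltac:(lra) ltac:(lra) ltac:(lra) ltac:(lra) ud dv.
move: F G Ge.
set Q := M * _; set K := crossing_cost _ _ _;
set s3 := s ^+ 3; set w3 := (1 - r2) ^+ 3; set x3 := (r3 - r2) ^+ 3.
set y3 := (1 - r3) ^+ 3.
(* What remains is linear in the costs and cubes, which therefore become plain variables. *)
move: @K @Q @s3 @w3 @x3 @y3.
set X1 := cell_cost 0 s _; set X2 := cell_cost s _ _.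
set X3 := cell_cost _ r2 _; set X4 := cell_cost r2 _ _.
set X5 := cell_cost r3 _ _.
move: X1 X2 X3 X4 X5 => X1 X2 X3 X4 X5.
move=> K Q s3 w3 x3 y3; move: K Q s3 w3 x3 y3 => K Q s3 w3 x3 y3.
move=> F G Ge Q0 Qe A B C D De As Bs Cs E.
rewrite /center_bound /=; have [d8|d8] := leP d (- 1 / 8).
  by left; have {F} := F d8; clear - Q0 A B C D E; lra.
right; exists d; split; first exact: ltW.
  by clear - G Q0 A B C D E; lra.
move=> TG d2.
(* The gap between the total and [center_cost d] is a positive combination of nonnegative slacks, so
   each slack vanishes. *)
have [Q1 A1 B1 C1 D1] : [/\ Q = 0, X1 = s3 / 12, X4 = x3 / 12, X5 = y3 / 12
    & x3 + y3 = w3 / 4].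
  by clear - G Q0 A B C D E TG; split; lra.
have K1 : s3 / 12 + K + w3 / 12 = center_cost d.
  by clear - TG Q1 A1 B1 C1 D1 E; lra.
(* For d strictly between -1/2 and 1/2 all cells have positive length, so equality in a cell
   determines its codepoint. *)
have d3 : - 1 / 2 < d by clear - d8; lra.
have [u1 v1] := Ge d3 d2 K1.
have r2l : 0 < 1 - r2 by clear - v1 d2; lra.
have e0 := De r2l D1.
have r2r3 : r2 < r3 by clear - r2l e0; lra.
have r3l : r3 < 1 by clear - r2l e0; lra.
have s0' : 0 < s by clear - u1 d8; lra.
have M1 : 0 < M by rewrite /M; clear - v1 u1 d2 d8; lra.
have e2 := Qe M1 Q1.
have e1 := As s0' A1.
have e3 := Bs r2r3 B1.
have e4 := Cs r3l C1.
by clear - u1 v1 e0 e1 e2 e3 e4; split; lra.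
Qed.

(** [s1], [s2], [s3] and [r1], [r2], [r3] are the same three cell boundaries clamped to the left and
    to the right half. A boundary is interior to at most one half, whence the three alternatives;
    how many fall on each side tells which cell crosses. *)
Lemma cost_center_bound (R : realFieldType) (a1 a2 a3 a4 s1 s2 s3 r1 r2 r3 : R) :
  0 <= s1 -> s1 <= s2 -> s2 <= s3 -> s3 <= 1 / 2 ->
  1 / 2 <= r1 -> r1 <= r2 -> r2 <= r3 -> r3 <= 1 ->
  s1 = 1 / 2 \/ r1 = 1 / 2 ->
  s2 = 1 / 2 \/ r2 = 1 / 2 ->
  s3 = 1 / 2 \/ r3 = 1 / 2 ->
  let T := cell_cost 0 s1 a1 + cell_cost s1 s2 a2 + cell_cost s2 s3 a3
           + cell_cost s3 (1 / 2) a4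
    + 4 * (cell_cost (1 / 2) r1 a1 + cell_cost r1 r2 a2 + cell_cost r2 r3 a3
           + cell_cost r3 1 a4) in
  center_bound a1 a2 a3 a4 T.
Proof.
move=> s10 s12 s23 s3h hr1 r12 r23 r31 c1 c2 c3 T.
have c0 x a : cell_cost x x a = 0 :> R by rewrite /cell_cost subrr mul0r.
have cubeh : (1 - 1 / 2) ^+ 3 = 1 / 8 :> R by field.
have cubeh0 : (1 / 2 - 0) ^+ 3 = 1 / 8 :> R by field.
have R4 := cost4_ge a1 a2 a3 a4 hr1 r12 r23 r31; rewrite cubeh in R4.
have [s1h|s1h] := eqVneq s1 (1 / 2).
  have s2h : s2 = 1 / 2 by lra. have s3h' : s3 = 1 / 2 by lra.
  have L1 := cell_cost_ge a1 s10.
  by left; rewrite /T; move: R4 L1; rewrite s1h s2h s3h' !c0 cubeh0; clear; lra.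
have r1h : r1 = 1 / 2 by case: c1 => // /eqP; rewrite (negbTE s1h).
have [s2h|s2h] := eqVneq s2 (1 / 2).
  have s3h' : s3 = 1 / 2 by lra.
  have := @cost_crossing_second R a1 a2 a3 a4 s1 r2 r3.
  rewrite /T r1h s2h s3h' !c0 !(add0r, addr0).
  by apply; lra.
have r2h : r2 = 1 / 2 by case: c2 => // /eqP; rewrite (negbTE s2h).
left.
have [s3h'|s3h'] := eqVneq s3 (1 / 2).
  (* Three cells on the left and two on the right cost at least 1/864 + 1/96 = 5/432, the source of
     the constant in [center_bound]. *)
  have s2h1 : s2 <= 1 / 2 by lra.
  have r3h : 1 / 2 <= r3 by lra.
  have := cost3_ge a1 a2 a3 s10 s12 s2h1.
  have := cost2_ge a3 a4 r3h r31.
  by rewrite /T r1h r2h s3h' !c0 cubeh cubeh0; clear; lra.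
have r3h : r3 = 1 / 2 by case: c3 => // /eqP; rewrite (negbTE s3h').
have := cost4_ge a1 a2 a3 a4 s10 s12 s23 s3h.
have h1 : 1 / 2 <= 1 :> R by lra.
have := cell_cost_ge a4 h1.
by rewrite /T r1h r2h r3h !c0 cubeh cubeh0; clear; lra.
Qed.

Lemma center_bound_ge (R : realFieldType) (a1 a2 a3 a4 T : R) :
  center_bound a1 a2 a3 a4 T ->
  7325 / (6 * 332 ^+ 2) <= T /\ (T = 7325 / (6 * 332 ^+ 2) ->
  [/\ a1 = 59 / 332, a2 = 177 / 332, a3 = 239 / 332 & a4 = 301 / 332]).
Proof.
have h : 7325 / (6 * 332 ^+ 2) < 5 / 432 :> R by lra.
case=> [T5|[d [d8 gT Te]]].
  split; first by rewrite ltW // (lt_le_trans h).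
  by move=> TV; move: (lt_le_trans h T5); rewrite TV ltxx.
have G := center_cost_ge d8; split; first exact: le_trans G gT.
move=> TV; rewrite -TV in G.
have TE : T = center_cost d by apply/le_anti; rewrite G gT.
have d1 : d = 11 / 332 by apply: center_cost_eq; rewrite // -TE.
have d2 : d < 1 / 2 by rewrite d1; clear; lra.
have [-> -> -> ->] := Te TE d2.
by rewrite d1; clear; split; field.
Qed.

(** * The pointwise minimum of squared distances *)

Section min_sqdist.
Variable R : realType.
Implicit Types (alpha : {fset R}) (x a : R).

Lemma min_sqdist_le alpha x a : a \in alpha ->
  (min_sqdist alpha x <= ((x - a) ^+ 2)%:E)%E.
Proof.
rewrite /min_sqdist -[a \in alpha]/(a \in enum_fset alpha).
elim: (enum_fset alpha) => // b s IH.
rewrite big_cons inE ge_min => /predU1P[->|/IH ->]; first by rewrite lexx.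
by rewrite orbT.
Qed.

Lemma le_min_sqdist alpha x (y : \bar R) :
  (forall a, a \in alpha -> (y <= ((x - a) ^+ 2)%:E)%E) ->
  (y <= min_sqdist alpha x)%E.
Proof.
move=> H; have {}H a : a \in enum_fset alpha -> (y <= ((x - a) ^+ 2)%:E)%E.
  exact: H.
rewrite /min_sqdist; elim: (enum_fset alpha) H => [|b s IH] H.
  by rewrite big_nil leey.
rewrite big_cons le_min H ?inE ?eqxx //= IH // => a sa.
by rewrite H // inE sa orbT.
Qed.

Lemma min_sqdist_eq alpha x a : a \in alpha ->
  (forall b, b \in alpha -> (x - a) ^+ 2 <= (x - b) ^+ 2) ->
  min_sqdist alpha x = ((x - a) ^+ 2)%:E.
Proof.
move=> aal H; apply/le_anti; rewrite min_sqdist_le //=.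
by apply: le_min_sqdist => b /H; rewrite lee_fin.
Qed.

Lemma min_sqdist_ge0 alpha x : (0 <= min_sqdist alpha x)%E.
Proof. by apply: le_min_sqdist => a _; rewrite lee_fin sqr_ge0. Qed.

Lemma measurable_min_sqdist alpha : measurable_fun setT (min_sqdist alpha).
Proof.
rewrite (_ : min_sqdist alpha = fun x =>
  \big[Order.min/+oo%E]_(a <- enum_fset alpha) ((x - a) ^+ 2)%:E) //.
elim: (enum_fset alpha) => [|a s IH].
  by under eq_fun do rewrite big_nil; exact: measurable_cst.
under eq_fun do rewrite big_cons; apply: measurable_mine => //.
apply/measurable_EFinP/measurable_funX.
by apply: measurable_funB => //; exact: measurable_id.
Qed.

End min_sqdist.

(** * Integrals over cells *)

Section cells.
Variable R : realType.
Let mu := @lebesgue_measure R.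

Lemma integral_sqdist (l r a : R) : l <= r ->
  (\int[mu]_(x in `[l, r]) ((x - a) ^+ 2)%:E = (cell_cost l r a)%:E)%E.
Proof.
rewrite le_eqVlt => /predU1P[->|lr].
  by rewrite set_itv1 integral_set1 /cell_cost subrr mul0r.
pose F := fun x : R => (x - a) ^+ 3 / 3.
have dF (x : R) : is_derive x 1 F ((x - a) ^+ 2).
  rewrite /F; apply: is_derive_eq.
  by rewrite /GRing.scale /=; field.
have cF (x : R) : {for x, continuous F}.
  by apply: differentiable_continuous; apply/derivable1_diffP.
rewrite (@continuous_FTC2 _ _ F) //.
- by rewrite -EFinB /F /cell_cost mulrBl.
- apply: continuous_subspaceT => x.
  apply: (@continuous_comp _ _ _ (fun x => x - a) (fun y => y ^+ 2)).
    by apply: continuousB; [exact: cvg_id|exact: cst_continuous].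
  exact: exprn_continuous.
- split=> [x _| |].
  + exact: ex_derive.
  + by apply: cvg_at_right_filter; exact: cF.
  + by apply: cvg_at_left_filter; exact: cF.
- by move=> x _; rewrite derive1E derive_val.
Qed.

(** Endpoints are left out of the hypothesis because a clamped cell may collapse to a point at which
    [a] is not a nearest codepoint. *)
Lemma integral_cell (phi : R -> \bar R) (l r a : R) : l <= r ->
  measurable_fun setT phi ->
  (forall x, l < x < r -> phi x = ((x - a) ^+ 2)%:E) ->
  (\int[mu]_(x in `[l, r]) phi x = (cell_cost l r a)%:E)%E.
Proof.
move=> lr mphi H; rewrite -integral_sqdist //.
have mg : measurable_fun setT (fun x : measurableTypeR R => ((x - a) ^+ 2)%:E).
  apply/measurable_EFinP/measurable_funX.
  by apply: measurable_funB => //; exact: measurable_id.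
rewrite (@integral_itv_bndoo _ _ _ phi)
  1?(@integral_itv_bndoo _ _ _ (fun x => ((x - a) ^+ 2)%:E)).
- by apply: eq_integral => x; rewrite inE /= in_itv /= => /H.
- exact: measurable_funTS.
- exact: measurable_funTS.
Qed.

Lemma ge0_integral_itv_split (phi : R -> \bar R) (l m r : R) :
  l <= m -> m <= r -> measurable_fun setT phi -> (forall x, 0 <= phi x)%E ->
  (\int[mu]_(x in `[l, r]) phi x =
   \int[mu]_(x in `[l, m]) phi x + \int[mu]_(x in `[m, r]) phi x)%E.
Proof.
move=> lm mr mphi phi0.
rewrite (@itv_bndbnd_setU _ _ _ (BRight m)) ?bnd_simp //.
rewrite ge0_integral_setU //=.
- by rewrite integral_itv_obnd_cbnd //; exact: measurable_funTS.
- exact: measurable_funTS.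
- apply/disj_setPRL => x /=; rewrite !in_itv /= => /andP[mx _].
  by apply/negP; rewrite negb_and -!ltNge mx orbT.
Qed.

End cells.

(** * Voronoi cells clamped to an interval *)

Lemma sqdist_le_right (R : realFieldType) (x a b : R) :
  a <= b -> x <= (a + b) / 2 -> (x - a) ^+ 2 <= (x - b) ^+ 2.
Proof.
move=> ab xab; rewrite -subr_ge0.
rewrite (_ : _ - _ = (b - a) * (a + b - 2 * x)); last by ring.
by rewrite mulr_ge0 ?subr_ge0 //; lra.
Qed.

Lemma sqdist_le_left (R : realFieldType) (x a b : R) :
  b <= a -> (b + a) / 2 <= x -> (x - a) ^+ 2 <= (x - b) ^+ 2.
Proof.
move=> ba bax; rewrite -subr_ge0.
rewrite (_ : _ - _ = (a - b) * (2 * x - (b + a))); last by ring.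
by rewrite mulr_ge0 ?subr_ge0 //; lra.
Qed.

Definition clamp (R : realFieldType) (l r m : R) : R :=
  Order.max l (Order.min m r).

Section clamp.
Variables (R : realFieldType) (l r : R).
Hypothesis lr : l <= r.

Lemma clamp_ge m : l <= clamp l r m.
Proof. by rewrite /clamp le_max lexx. Qed.

Lemma clamp_le m : clamp l r m <= r.
Proof. by rewrite /clamp ge_max lr ge_min lexx orbT. Qed.

Lemma clamp_mono m n : m <= n -> clamp l r m <= clamp l r n.
Proof.
move=> mn; rewrite /clamp ge_max !le_max lexx /= le_min !ge_min.
by rewrite mn lexx !orbT.
Qed.

Lemma lt_clamp x m : l < x -> x < clamp l r m -> x <= m.
Proof.
move=> lx; rewrite /clamp lt_max ltNge (ltW lx) /= lt_min => /andP[/ltW//].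
Qed.

Lemma clamp_lt x m : x < r -> clamp l r m < x -> m <= x.
Proof.
move=> xr; rewrite /clamp gt_max gt_min => /andP[_ /orP[/ltW//|]].
by rewrite ltNge (ltW xr).
Qed.

Lemma clamp_id m : l <= m -> m <= r -> clamp l r m = m.
Proof. by move=> lm mr; rewrite /clamp min_l // max_r. Qed.

Lemma clamp_low m : m <= l -> clamp l r m = l.
Proof. by move=> ml; rewrite /clamp max_l // ge_min ml. Qed.

Lemma clamp_high m : r <= m -> clamp l r m = r.
Proof. by move=> rm; rewrite /clamp min_r // max_r. Qed.

End clamp.

(** Clamping the midpoints of consecutive codepoints tiles [l, r] by four cells, some possibly of
    length 0, with no case analysis on which Voronoi cells meet [l, r]. *)
Definition cells_cost (R : realFieldType) (a1 a2 a3 a4 l r : R) : R :=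
  let s1 := clamp l r ((a1 + a2) / 2) in
  let s2 := clamp l r ((a2 + a3) / 2) in
  let s3 := clamp l r ((a3 + a4) / 2) in
  cell_cost l s1 a1 + cell_cost s1 s2 a2 + cell_cost s2 s3 a3
  + cell_cost s3 r a4.

Lemma integral_min_sqdist (R : realType) (alpha : {fset R})
    (a1 a2 a3 a4 l r : R) :
  alpha =i [:: a1; a2; a3; a4] -> a1 <= a2 -> a2 <= a3 -> a3 <= a4 -> l <= r ->
  (\int[@lebesgue_measure R]_(x in `[l, r]) min_sqdist alpha x =
   (cells_cost a1 a2 a3 a4 l r)%:E)%E.
Proof.
move=> alphaE a12 a23 a34 lr; rewrite /cells_cost /=.
set m1 := (a1 + a2) / 2; set m2 := (a2 + a3) / 2; set m3 := (a3 + a4) / 2.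
have m12 : m1 <= m2 by rewrite /m1 /m2; lra.
have m23 : m2 <= m3 by rewrite /m2 /m3; lra.
have s1l := clamp_ge l r m1; have s3r := clamp_le lr m3.
have s12 := clamp_mono l r m12; have s23 := clamp_mono l r m23.
have s1r := clamp_le lr m1; have s2r := clamp_le lr m2.
have mphi := measurable_min_sqdist alpha.
have phi0 := min_sqdist_ge0 alpha.
rewrite (ge0_integral_itv_split s1l s1r) //.
rewrite (ge0_integral_itv_split s12 s2r) //.
rewrite (ge0_integral_itv_split s23 s3r) //.
rewrite (@integral_cell _ _ _ _ a1) //; last first.
  move=> x /andP[lx xr].
  have xm : x <= m1 by apply: lt_clamp xr.
  rewrite /m1 in xm; clear - alphaE a12 a23 a34 xm.
  apply: min_sqdist_eq => [|b]; rewrite alphaE !inE ?eqxx ?orbT //.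
  case/or4P => /eqP ->; [exact: lexx | apply: sqdist_le_right; lra..].
rewrite (@integral_cell _ _ _ _ a2) //; last first.
  move=> x /andP[lx xr].
  have xm : x <= m2.
    by apply: lt_clamp xr; apply: le_lt_trans lx; exact: clamp_ge.
  have mx : m1 <= x by apply: clamp_lt lx; exact: lt_le_trans xr _.
  rewrite /m1 /m2 in xm mx; clear - alphaE a12 a23 a34 xm mx.
  apply: min_sqdist_eq => [|b]; rewrite alphaE !inE ?eqxx ?orbT //.
  case/or4P => /eqP ->;
    [apply: sqdist_le_left; lra | exact: lexx | apply: sqdist_le_right; lra..].
rewrite (@integral_cell _ _ _ _ a3) //; last first.
  move=> x /andP[lx xr].
  have xm : x <= m3.
    by apply: lt_clamp xr; apply: le_lt_trans lx; exact: clamp_ge.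
  have mx : m2 <= x by apply: clamp_lt lx; exact: lt_le_trans xr _.
  rewrite /m2 /m3 in xm mx; clear - alphaE a12 a23 a34 xm mx.
  apply: min_sqdist_eq => [|b]; rewrite alphaE !inE ?eqxx ?orbT //.
  case/or4P => /eqP ->;
    [apply: sqdist_le_left; lra | apply: sqdist_le_left; lra
    | exact: lexx | apply: sqdist_le_right; lra].
rewrite (@integral_cell _ _ _ _ a4) //; last first.
  move=> x /andP[lx xr].
  have mx : m3 <= x by apply: clamp_lt lx.
  rewrite /m3 in mx; clear - alphaE a12 a23 a34 mx.
  apply: min_sqdist_eq => [|b]; rewrite alphaE !inE ?eqxx ?orbT //.
  case/or4P => /eqP ->;
    [apply: sqdist_le_left; lra | apply: sqdist_le_left; lra
    | apply: sqdist_le_left; lra | exact: lexx].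
by rewrite -!EFinD !addrA.
Qed.

(** * From P to Lebesgue measure *)

Section density.
Variables (R : realType) (P : probability (measurableTypeR R) R).
Local Notation mu := (@lebesgue_measure R).

(** On measurable subsets of [D], [P] agrees with c times Lebesgue measure, and the integral over
    [D] depends on nothing else. *)
Lemma integral_density_cst (f : R -> R) (c : {nonneg R})
    (D : set (measurableTypeR R)) (phi : R -> \bar R) :
  has_density P f -> measurable D -> (forall x, D x -> f x = c%:num) ->
  measurable_fun setT phi -> (forall x, 0 <= phi x)%E ->
  (\int[P]_(x in D) phi x = c%:num%:E * \int[mu]_(x in D) phi x)%E.
Proof.
move=> HP mD fD mphi phi0; rewrite -ge0_integral_mscale //; last first.
  exact: measurable_funTS.
apply: eq_measure_integral => A mA AD.
rewrite [LHS](HP A mA) (eq_integral (cst c%:num%:E)); last first.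
  by move=> x; rewrite inE => /AD /fD ->.
by rewrite integral_cst.
Qed.

Lemma distortion_two_step (alpha : {fset R}) :
  has_density P (@two_step_density R) ->
  (distortion P alpha =
   (2 / 5)%:E * \int[mu]_(x in `[0%R, (1 / 2)%R]) min_sqdist alpha x +
   (8 / 5)%:E * \int[mu]_(x in `[(1 / 2)%R, 1%R]) min_sqdist alpha x)%E.
Proof.
move=> HP; have mphi := measurable_min_sqdist alpha.
have phi0 := min_sqdist_ge0 alpha.
have c1 : 0 <= 2 / 5 :> R by lra.
have c2 : 0 <= 8 / 5 :> R by lra.
rewrite /distortion.
rewrite -(setUv (`[0%R, 1%R]%classic : set R)) ge0_integral_setU //=; last 3 first.
- exact: measurableC.
- by rewrite setUv.
- by apply/disj_setPCl.
rewrite [X in (_ + X)%E](@integral_density_cst _ 0%:nng _ _ HP) //; last 2 first.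
- exact: measurableC.
- move=> x /=; rewrite in_itv /= => /negP h; rewrite /two_step_density.
  case: ifPn => [/andP[? ?]|_].
    by exfalso; move/negP: h; apply; apply/andP; split; lra.
  case: ifPn => [/andP[? ?]|//].
  by exfalso; move/negP: h; apply; apply/andP; split; lra.
(* The Lebesgue integral over the complement is infinite, but 0 times +oo is 0. *)
rewrite mul0e adde0.
rewrite (@itv_bndbnd_setU _ _ _ (BRight (1 / 2))) ?bnd_simp; [|lra|lra].
rewrite ge0_integral_setU //=; last 2 first.
- exact: measurable_funTS.
- apply/disj_setPRL => x /=; rewrite !in_itv /= => /andP[mx _].
  by apply/negP; rewrite negb_and -!ltNge mx orbT.
rewrite (@integral_density_cst _ (NngNum c1) _ _ HP) //; last first.
  by move=> x /=; rewrite in_itv /= /two_step_density => ->.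
rewrite (@integral_density_cst _ (NngNum c2) _ _ HP) //; last first.
  move=> x /=; rewrite in_itv /= /two_step_density => /andP[x1 x2].
  by rewrite [x <= 1 / 2]leNgt x1 andbF x2.
by rewrite integral_itv_obnd_cbnd //; exact: measurable_funTS.
Qed.

End density.

(** * Distortion through four sorted codepoints *)

(** Smaller sets are padded by repeating their largest element, so that four weakly increasing
    codepoints cover every nonempty case. *)
Lemma fset_enum4 (R : realDomainType) (alpha : {fset R}) :
  alpha != fset0 -> (#|` alpha| <= 4)%N -> exists a1 a2 a3 a4,
  [/\ alpha =i [:: a1; a2; a3; a4], a1 <= a2, a2 <= a3 & a3 <= a4].
Proof.
rewrite -cardfs_gt0; set s := sort <=%O (enum_fset alpha).
have sE : alpha =i s by move=> x; rewrite mem_sort.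
have -> : #|` alpha| = size s by rewrite size_sort.
have : sorted <=%O s by apply: sort_sorted; exact: le_total.
case: s sE => [|a [|b [|c [|d [|e s]]]]] //= sE sd _ _.
- exists a, a, a, a; split=> // x; rewrite sE !inE.
  by case: eqP.
- case/andP: sd => ab _; exists a, b, b, b; split=> // x; rewrite sE !inE.
  by do !case: eqP.
- case/and3P: sd => ab bc _; exists a, b, c, c; split=> // x; rewrite sE !inE.
  by do !case: eqP.
- by case/and4P: sd => ab bc cd _; exists a, b, c, d.
Qed.

Lemma distortion_cells (R : realType) (P : probability (measurableTypeR R) R)
    (alpha : {fset R}) (a1 a2 a3 a4 : R) :
  has_density P (@two_step_density R) ->
  alpha =i [:: a1; a2; a3; a4] -> a1 <= a2 -> a2 <= a3 -> a3 <= a4 ->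
  distortion P alpha = (2 / 5 * (cells_cost a1 a2 a3 a4 0 (1 / 2)
    + 4 * cells_cost a1 a2 a3 a4 (1 / 2) 1))%:E.
Proof.
move=> HP alphaE a12 a23 a34; rewrite distortion_two_step //.
have h0 : 0 <= 1 / 2 :> R by lra.
have h1 : 1 / 2 <= 1 :> R by lra.
rewrite !(integral_min_sqdist alphaE) // -!EFinM -EFinD; congr (_%:E).
by field.
Qed.

Lemma distortion_fset0 (R : realType) (P : probability (measurableTypeR R) R) :
  distortion P fset0 = +oo%E.
Proof.
rewrite /distortion (eq_integral (cst +oo%E)); last first.
  by move=> x _; rewrite /min_sqdist big_seq_fset0.
by rewrite integral_cst // [X in (_ * X)%E](probability_setT P) mule1.
Qed.

Lemma clamp_half (R : realFieldType) (m : R) :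
  clamp 0 (1 / 2) m = 1 / 2 \/ clamp (1 / 2) 1 m = 1 / 2.
Proof.
have [mh|/ltW hm] := leP m (1 / 2); [right|left].
- by apply: clamp_low => //; lra.
- by apply: clamp_high => //; lra.
Qed.

Lemma cells_cost_center_bound (R : realFieldType) (a1 a2 a3 a4 : R) :
  a1 <= a2 -> a2 <= a3 -> a3 <= a4 ->
  center_bound a1 a2 a3 a4 (cells_cost a1 a2 a3 a4 0 (1 / 2)
    + 4 * cells_cost a1 a2 a3 a4 (1 / 2) 1).
Proof.
move=> a12 a23 a34.
have h0 : 0 <= 1 / 2 :> R by lra.
have h1 : 1 / 2 <= 1 :> R by lra.
have m12 : (a1 + a2) / 2 <= (a2 + a3) / 2 by lra.
have m23 : (a2 + a3) / 2 <= (a3 + a4) / 2 by lra.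
rewrite /cells_cost /=; apply: cost_center_bound;
  by [exact: clamp_ge|exact: clamp_le|exact: clamp_mono|exact: clamp_half].
Qed.

(** * Optimality and uniqueness *)

Section optimal.
Variables (R : realType) (P : probability (measurableTypeR R) R).
Hypothesis HP : has_density P (@two_step_density R).

Let opt : {fset R} := [fset 59 / 332; 177 / 332; 239 / 332; 301 / 332].
Let V : R := 1465 / (3 * 332 ^+ 2).

Lemma distortion_opt : distortion P opt = V%:E.
Proof.
rewrite (@distortion_cells _ _ _ (59 / 332) (177 / 332) (239 / 332) (301 / 332));
  [|exact: HP| by move=> x; rewrite !inE -!orbA | lra..].
congr (_%:E); rewrite /cells_cost /V.
have -> : (59 / 332 + 177 / 332) / 2 = 118 / 332 :> R by field.
have -> : (177 / 332 + 239 / 332) / 2 = 208 / 332 :> R by field.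
have -> : (239 / 332 + 301 / 332) / 2 = 270 / 332 :> R by field.
rewrite (@clamp_id R 0 (1 / 2) (118 / 332)); [|lra..].
rewrite (@clamp_low R (1 / 2) 1 (118 / 332)); [|lra..].
rewrite !(@clamp_high R 0 (1 / 2)); [|lra..].
rewrite !(@clamp_id R (1 / 2) 1); [|lra..].
by rewrite /cell_cost; field.
Qed.

Lemma distortion_ge (alpha : {fset R}) : (#|` alpha| <= 4)%N ->
  (V%:E <= distortion P alpha)%E /\
  (distortion P alpha = V%:E -> alpha = opt).
Proof.
move=> alpha4; have [->|alpha0] := eqVneq alpha fset0.
  by rewrite distortion_fset0 leey; split.
have [a1 [a2 [a3 [a4 [alphaE a12 a23 a34]]]]] := fset_enum4 alpha0 alpha4.
rewrite (distortion_cells HP alphaE) // lee_fin.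
have := center_bound_ge (cells_cost_center_bound a12 a23 a34).
set T := _ + _; move=> [VT TE].
have VE : V = 2 / 5 * (7325 / (6 * 332 ^+ 2)) by rewrite /V; field.
split; first by rewrite VE ler_wpM2l.
move=> [TV]; have [|e1 e2 e3 e4] := TE.
  by apply: (@mulfI _ (2 / 5)); rewrite ?TV // gt_eqF.
by apply/fsetP => x; rewrite alphaE !inE -!orbA e1 e2 e3 e4.
Qed.

Lemma card_opt : (#|` opt| <= 4)%N.
Proof.
have U (A : {fset R}) x n :
    (#|` A| <= n)%N -> (#|` (A `|` [fset x])%fset| <= n.+1)%N.
  by move=> An; rewrite cardfsU cardfs1 (leq_trans (leq_subr _ _)) // addn1.
by do 3 apply: (U); rewrite cardfs1.
Qed.

End optimal.

(* 330672 = 3 * 332 ^ 2; ring numerals are unary naturals, so the literal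
   330672 overflows the parser's stack. *)
Theorem proposition4p5 (R : realType)
    (P : probability (measurableTypeR R) R)
    (HP : has_density P (@two_step_density R)) :
  (forall alpha : {fset R},
     optimal_set_of_means P 4 alpha <->
     alpha = [fset 59 / 332; 177 / 332; 239 / 332; 301 / 332]) /\
  quantization_error P 4 = (1465 / (3 * 332 ^+ 2))%:E.
Proof.
have VE : quantization_error P 4 = (1465 / (3 * 332 ^+ 2))%:E.
  apply/le_anti/andP; split.
    rewrite -(distortion_opt HP); apply: ereal_inf_lbound.
    exists [fset 59 / 332; 177 / 332; 239 / 332; 301 / 332] => //.
    exact: card_opt.
  apply: le_ereal_inf_tmp => _ [alpha alpha4 <-].
  by have [] := distortion_ge HP alpha4.
split=> // alpha; split=> [[alpha4 aV]|->].
  by have [_] := distortion_ge HP alpha4; apply; rewrite aV VE.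
by split; [exact: card_opt|rewrite VE distortion_opt].
Qed.
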